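(* Let $C:y=y(x)$ be a smooth regular curve in $A^2$, and let $$\alpha_1=\left(\frac{-\sqrt3\,(y_xy_{xxx}-3y_{xx}^2)\,|3y_{xx}y_{xxxx}-5y_{xxx}^2|^{1/2}}{9y_{xx}^3},\ \frac{\sqrt3\,y_{xxx}\,|3y_{xx}y_{xxxx}-5y_{xxx}^2|^{1/2}}{9y_{xx}^3}\right),$$ $$\alpha_2=\left(-\frac{y_x}{3y_{xx}^3}|3y_{xx}y_{xxxx}-5y_{xxx}^2|,\ \frac{1}{3y_{xx}^3}|3y_{xx}y_{xxxx}-5y_{xxx}^2|\right)$$ be the right moving frame of $C$. Then the moving equation of the right moving frame is $$\frac{d}{ds}\begin{pmatrix}\alpha_1\\ \alpha_2\end{pmatrix}=\begin{pmatrix}\frac12k(s)&\frac13\sigma\\ -1&k(s)\end{pmatrix}\begin{pmatrix}\alpha_1\\ \alpha_2\end{pmatrix}.$$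
   Context: $A^2$ is the real affine plane with affine coordinates $(x,y)$. Subscripts $x$ denote derivatives of $y(x)$. A smooth curve $y=y(x)$ is regular if $S_1=y_{xx}\neq0$ and $S_2=3y_{xx}y_{xxxx}-5y_{xxx}^2\neq0$ at all of its points. For a regular curve, $\sigma=\mathrm{sgn}(S_2)\in\{1,-1\}$; the invariant arc element is $ds=\frac{|S_2|^{1/2}}{\sqrt3\,y_{xx}}dx$, so $\frac{d}{ds}=\frac{\sqrt3\,y_{xx}}{|S_2|^{1/2}}\frac{d}{dx}$; and the curvature is $$k=\frac{\sqrt3\,(9y_{xx}^2y_{xxxxx}-45y_{xx}y_{xxx}y_{xxxx}+40y_{xxx}^3)}{3|S_2|^{3/2}},$$ written $k(s)$ as a function of the arc parameter $s$.
   Formalization: The diagonal entries of the matrix are σk/2 and σk instead of k/2 and k; the printed equation holds when σ = 1 but fails when σ = −1 and k ≠ 0, for example for y = exp x. *)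

(* Defs.v *)
From HB Require Import structures.
From mathcomp Require Import all_boot all_order all_algebra.
From mathcomp Require Import all_classical all_reals all_analysis.

Set Implicit Arguments.
Unset Strict Implicit.
Unset Printing Implicit Defensive.

Import Order.TTheory GRing.Theory Num.Theory.
Import numFieldNormedType.Exports.

Local Open Scope classical_set_scope.
Local Open Scope ring_scope.

(* In ring_scope these notations denote derivatives of polynomials. *)
Local Notation "f ^` ()" := (derive1 f) : ring_scope.
Local Notation "f ^` ( n )" := (derive1n n f) : ring_scope.

Section AffineCurve.
Context {R : realType}.
Implicit Types (D : set R) (y : R -> R) (x : R).

Definition smooth_on D y : Prop :=
  forall (n : nat) x, D x -> derivable (y^`(n)) x 1.

Definition S1 y x : R := y^`(2) x.

Definition S2 y x : R := 3 * y^`(2) x * y^`(4) x - 5 * y^`(3) x ^+ 2.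

Definition regular_on D y : Prop :=
  forall x, D x -> S1 y x != 0 /\ S2 y x != 0.

Definition sigma y x : R := Num.sg (S2 y x).

(* d/ds, for ds = |S2|^(1/2) / (sqrt 3 * y_xx) dx. Functions on the curve are
   given as functions of x; f^`() is an arbitrary value where f is not
   derivable, so statements about dds should also assert derivability. *)
Definition dds y {V : normedModType R} (f : R -> V) x : V :=
  (Num.sqrt 3 * y^`(2) x / Num.sqrt `|S2 y x|) *: f^`() x.

(* |S2|^(3/2) is written as (sqrt |S2|)^3. *)
Definition curvature y x : R :=
  Num.sqrt 3 * (9 * y^`(2) x ^+ 2 * y^`(5) x
                - 45 * y^`(2) x * y^`(3) x * y^`(4) x
                + 40 * y^`(3) x ^+ 3)
  / (3 * Num.sqrt `|S2 y x| ^+ 3).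

Definition row2 (u v : R) : 'rV[R]_2 := \row_(j < 2) [:: u; v]`_j.

Definition alpha1 y x : 'rV[R]_2 :=
  row2
    (- Num.sqrt 3 * (y^`(1) x * y^`(3) x - 3 * y^`(2) x ^+ 2)
       * Num.sqrt `|S2 y x| / (9 * y^`(2) x ^+ 3))
    (Num.sqrt 3 * y^`(3) x * Num.sqrt `|S2 y x| / (9 * y^`(2) x ^+ 3)).

Definition alpha2 y x : 'rV[R]_2 :=
  row2
    (- (y^`(1) x / (3 * y^`(2) x ^+ 3)) * `|S2 y x|)
    (1 / (3 * y^`(2) x ^+ 3) * `|S2 y x|).

Definition right_frame y x : 'M[R]_2 :=
  \matrix_(i < 2) [:: alpha1 y x; alpha2 y x]`_i.

(* Pitfall: the diagonal entries are sigma * k / 2 and sigma * k. The version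
   printed with k / 2 and k agrees with this where sigma = 1, but is false
   where sigma = -1 and k != 0, already for y = exp x. *)
Definition frame_matrix y x : 'M[R]_2 :=
  \matrix_(i < 2)
    [:: row2 (2^-1 * (sigma y x * curvature y x)) (3^-1 * sigma y x);
        row2 (-1) (sigma y x * curvature y x)]`_i.

End AffineCurve.

(* Main.v *)
Require Import Defs.
From HB Require Import structures.
From mathcomp Require Import all_boot all_order all_algebra.
From mathcomp Require Import all_classical all_reals all_analysis.
From mathcomp Require Import ring.
Import Order.TTheory GRing.Theory Num.Theory.
Import numFieldNormedType.Exports.
Local Open Scope classical_set_scope.
Local Open Scope ring_scope.

(** Read the rows of the frame as covectors and pair them with the tangent
    vector [(1, y')] of the curve. The row [alpha2] is conormal: its pairing
    vanishes, so [alpha2 = b (- y', 1)] with [b = |S2| / (3 y''^3)]; and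
    [alpha1 = c (1, 0) + a (- y', 1)], where [c = sqrt 3 |S2|^(1/2) / (3 y'')]
    is its pairing. Since [(- y', 1)' = (- y'', 0)], the moving equation is
    equivalent to four scalar identities, with [rho d/dx = d/ds]:
<<
      rho (c' - y'' a) = sigma k / 2 * c           rho y'' b = c
      rho a' = sigma k / 2 * a + sigma / 3 * b     rho b' = - a + sigma k b
>>
    The slope [y'] has disappeared from them. The functions [a], [b], [c] are
    rational in [y''], [y'''] and [w = |S2|^(1/2)]. On the curve [S2] does not
    vanish, hence [|S2|] is differentiable with derivative [sigma S2'], and
    [w' = sigma S2' / (2 w)] with [S2' = 3 y'' y^(5) - 7 y''' y^(4)]
    ([is_derive_S2], [is_derive_root_S2]). The identities then follow by
    clearing denominators and reducing modulo [sigma^2 = 1] and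
    [w^2 = sigma S2]; the factor [sigma] of [k] comes from differentiating the
    absolute value in [w] ([is_derive_tangent_part], [is_derive_height1],
    [is_derive_height2], [arc_rate_height2]). *)

Local Notation "f ^` ()" := (derive1 f) : ring_scope.
Local Notation "f ^` ( n )" := (derive1n n f) : ring_scope.

(** * Entrywise, absolute value and quotient rules for derivatives *)

Lemma ord2P (i : 'I_2) : i = 0 \/ i = 1.
Proof. by case: i => [[|[|i]] ?]; [left|right|]; try apply/val_inj. Qed.

Lemma mulmx2E (R : pzSemiRingType) m n (A : 'M[R]_(m, 2)) (B : 'M[R]_(2, n)) i j :
  (A *m B) i j = A i 0 * B 0 j + A i 1 * B 1 j.
Proof.
rewrite mxE !big_ord_recl big_ord0 addr0.
by congr (_ * _ + A i _ * B _ j); apply/val_inj.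
Qed.

Lemma is_derive_mx (R : realFieldType) (V : normedModType R) m n
    (M : V -> 'M[R]_(m, n)) (dM : 'M[R]_(m, n)) t v :
  (forall i j, is_derive t v (fun x => M x i j) (dM i j)) -> is_derive t v M dM.
Proof.
move=> HM; have dvM : derivable M t v.
  by apply/derivable_mxP => i j; case: (HM i j).
split=> //; rewrite derive_mx//; apply/matrixP => i j.
by rewrite mxE; case: (HM i j).
Qed.

(** The sign of a continuous function is locally constant where the function
    does not vanish, so there [`|f|] is locally a constant multiple of [f]. *)
Lemma is_derive_normr {R : realType} {f : R -> R} {x df : R} :
  f x != 0 -> is_derive x 1 f df ->
  is_derive x 1 (fun z => `|f z|) (Num.sg (f x) * df).
Proof.
move=> fx0 fdf; have fc : {for x, continuous f}.
  by apply/differentiable_continuous/derivable1_diffP; case: fdf.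
have : is_derive x 1 (Num.sg (f x) *: (f : R -> R^o)) (Num.sg (f x) * df).
  exact: is_deriveZ.
apply: near_eq_is_derive.
move: fx0; rewrite neq_lt => /orP[fx0|fx0].
- near=> z; rewrite ltr0_sg// ltr0_norm ?scaleN1r//.
  by near: z; exact: cvgr_lt fc _ fx0.
- near=> z; rewrite gtr0_sg// gtr0_norm ?scale1r//.
  by near: z; exact: cvgr_gt fc _ fx0.
Unshelve. all: by end_near. Qed.

Lemma is_derive_mul {R : realType} {f g : R -> R} {x df dg : R} :
  is_derive x 1 f df -> is_derive x 1 g dg ->
  is_derive x 1 (fun z => f z * g z) (f x * dg + g x * df).
Proof. by move=> ? ?; exact: is_deriveM. Qed.

Lemma is_derive_expr {R : realType} {f : R -> R} {x df : R} n :
  is_derive x 1 f df ->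
  is_derive x 1 (fun z => f z ^+ n.+1) (n.+1%:R * f x ^+ n * df).
Proof.
by move=> Hf; rewrite -(exprfctE f); exact: is_deriveX.
Qed.

Lemma is_derive_div {R : realType} {f g : R -> R} {x df dg : R} :
  is_derive x 1 f df -> is_derive x 1 g dg -> g x != 0 ->
  is_derive x 1 (fun z => f z / g z) ((df * g x - f x * dg) / g x ^+ 2).
Proof.
move=> Hf Hg gx0; have Hgi := is_deriveV gx0 Hg.
apply: is_derive_eq (is_derive_mul Hf Hgi) _.
by rewrite /GRing.scale/=; field.
Qed.

(** * The frame in coordinates adapted to the tangent *)

Section Coordinates.
Context {R : realType}.
Implicit Types (y : R -> R) (x : R).

Definition root_S2 y x : R := Num.sqrt `|S2 y x|.

Definition arc_rate y x : R := Num.sqrt 3 * y^`(2) x / root_S2 y x.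

(** The pairing [c] of [alpha1] with the tangent vector [(1, y')]. *)
Definition tangent_part y x : R := Num.sqrt 3 * root_S2 y x / (3 * y^`(2) x).

(** [height1] and [height2] are the coefficients [a] and [b] of the conormal
    vector [(- y', 1)]. *)
Definition height1 y x : R :=
  Num.sqrt 3 * y^`(3) x * root_S2 y x / (9 * y^`(2) x ^+ 3).

Definition height2 y x : R := root_S2 y x ^+ 2 / (3 * y^`(2) x ^+ 3).

Lemma alpha1E y x :
  alpha1 y x = row2 (tangent_part y x - y^`(1) x * height1 y x) (height1 y x).
Proof.
rewrite /alpha1 -/(root_S2 y x); congr (row2 _ _).
rewrite /tangent_part /height1.
move: (y^`(1) x) (y^`(2) x) (y^`(3) x) (root_S2 y x) (Num.sqrt 3) => p q r w s.
(* At points with y'' = 0 both sides vanish, since 0^-1 = 0. *)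
have [->|q0] := eqVneq q 0; last by field.
by rewrite !(expr0n, mulr0, invr0, subr0).
Qed.

Lemma alpha2E y x :
  alpha2 y x = row2 (- (y^`(1) x * height2 y x)) (height2 y x).
Proof.
rewrite /alpha2 /height2 /root_S2 sqr_sqrtr//.
move: (y^`(1) x) (y^`(2) x) `|S2 y x| => p q T.
by congr (row2 _ _); ring.
Qed.

Lemma right_frame00 y x :
  right_frame y x 0 0 = tangent_part y x - y^`(1) x * height1 y x.
Proof. by transitivity (alpha1 y x 0 0); [rewrite mxE|rewrite alpha1E mxE]. Qed.

Lemma right_frame01 y x : right_frame y x 0 1 = height1 y x.
Proof. by transitivity (alpha1 y x 0 1); [rewrite mxE|rewrite alpha1E mxE]. Qed.

Lemma right_frame10 y x : right_frame y x 1 0 = - (y^`(1) x * height2 y x).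
Proof. by transitivity (alpha2 y x 0 0); [rewrite mxE|rewrite alpha2E mxE]. Qed.

Lemma right_frame11 y x : right_frame y x 1 1 = height2 y x.
Proof. by transitivity (alpha2 y x 0 1); [rewrite mxE|rewrite alpha2E mxE]. Qed.

Lemma frame_matrix00 y x :
  frame_matrix y x 0 0 = 2^-1 * (sigma y x * curvature y x).
Proof. by rewrite !mxE. Qed.

Lemma frame_matrix01 y x : frame_matrix y x 0 1 = 3^-1 * sigma y x.
Proof. by rewrite !mxE. Qed.

Lemma frame_matrix10 y x : frame_matrix y x 1 0 = -1.
Proof. by rewrite !mxE. Qed.

Lemma frame_matrix11 y x : frame_matrix y x 1 1 = sigma y x * curvature y x.
Proof. by rewrite !mxE. Qed.

End Coordinates.

(** * Derivatives of the coordinates *)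

Section Derivatives.
Context {R : realType} {D : set R} {y : R -> R}.
Hypotheses (y_smooth : smooth_on D y) (y_regular : regular_on D y).
Context {x : R} (Dx : D x).

Local Notation p := (y^`(1) x).
Local Notation q := (y^`(2) x).
Local Notation r := (y^`(3) x).
Local Notation u := (y^`(4) x).
Local Notation v := (y^`(5) x).
Local Notation w := (root_S2 y x).
Local Notation e := (sigma y x).
Local Notation k := (curvature y x).
Local Notation s := (Num.sqrt (3 : R)).

Let is_derive_y n : is_derive x 1 (y^`(n)) (y^`(n.+1) x).
Proof. by split; [exact: (y_smooth n x Dx)|rewrite derive1nS derive1E]. Qed.

Let is_derive_const (a : R) : is_derive x 1 (fun=> a) 0.
Proof. exact: is_derive_cst. Qed.

Let q0 : q != 0. Proof. by case: (y_regular x Dx). Qed.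

Let S2_neq0 : S2 y x != 0. Proof. by case: (y_regular x Dx). Qed.

Let w_gt0 : 0 < w. Proof. by rewrite sqrtr_gt0 normr_gt0. Qed.

Let w0 : w != 0. Proof. exact: lt0r_neq0. Qed.

Let ss : s ^+ 2 = 3. Proof. by rewrite sqr_sqrtr. Qed.

Let s0 : s != 0. Proof. by rewrite sqrtr_eq0 -ltNge. Qed.

Let ee : e ^+ 2 = 1. Proof. by rewrite sqr_sg S2_neq0. Qed.

(* The definition of w as a monomial rewriting rule, which the decision
   procedure for field identities can use. *)
Let ww : w ^+ 2 = 3 * e * q * u - 5 * e * r ^+ 2.
Proof.
rewrite sqr_sqrtr// normrEsg -/(sigma y x) /S2.
by move: q r u e => *; ring.
Qed.

Lemma is_derive_S2 : is_derive x 1 (S2 y) (3 * q * v - 7 * r * u).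
Proof.
have Hqu := is_derive_mul (is_derive_mul (is_derive_const 3) (is_derive_y 2))
  (is_derive_y 4).
have Hrr := is_derive_mul (is_derive_const 5)
  (is_derive_mul (is_derive_y 3) (is_derive_y 3)).
apply: is_derive_eq (is_deriveB Hqu Hrr) _.
by move: q r u v => *; ring.
Qed.

Lemma is_derive_root_S2 :
  is_derive x 1 (root_S2 y) (e * (3 * q * v - 7 * r * u) / (2 * w)).
Proof.
have Hn := is_derive_normr S2_neq0 is_derive_S2.
have Hs : is_derive `|S2 y x| 1 Num.sqrt (2 * w)^-1.
  by apply: is_derive1_sqrt; rewrite normr_gt0.
have Hw : is_derive x 1 (root_S2 y) _ :=
  @is_derive1_comp R Num.sqrt (fun z => `|S2 y z|) x _ _ Hs Hn.
by apply: is_derive_eq Hw _; rewrite mulrC.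
Qed.

(** In the derivative of [alpha2 = b (- y', 1)], the term [b (- y'', 0)] gives
    [- c (1, 0)] per unit of arc, which is the component of [- alpha1] along
    [(1, 0)]. *)
Lemma arc_rate_height2 : arc_rate y x * q * height2 y x = tangent_part y x.
Proof.
rewrite /arc_rate /height2 /tangent_part.
by move: q w s q0 w0 => q' w' s' *; field; apply/andP.
Qed.

(** The term [y'' a] is the contribution of the derivative [(- y'', 0)] of the
    conormal vector [(- y', 1)]. *)
Lemma is_derive_tangent_part : is_derive x 1 (tangent_part y)
  ((arc_rate y x)^-1 * (2^-1 * (e * k) * tangent_part y x) + q * height1 y x).
Proof.
have Hn := is_derive_mul (is_derive_const s) is_derive_root_S2.
have Hd := is_derive_mul (is_derive_const 3) (is_derive_y 2).
have d0 : 3 * q != 0 by rewrite mulf_neq0.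
have H : is_derive x 1 (tangent_part y) _ := is_derive_div Hn Hd d0.
apply: is_derive_eq H _.
rewrite /arc_rate /height1 /tangent_part /curvature -/(root_S2 y x).
(* Without this abstraction, comparing the atoms would unfold the iterated
   derivatives. *)
move: q r u v w e s q0 w0 s0 ss ee ww
  => Q r3 r4 r5 W E S Q0 W0 S0 SS EE WW.
by field: SS EE WW; rewrite Q0 W0 S0.
Qed.

Lemma is_derive_height1 : is_derive x 1 (height1 y)
  ((arc_rate y x)^-1 *
   (2^-1 * (e * k) * height1 y x + 3^-1 * e * height2 y x)).
Proof.
have Hn := is_derive_mul
  (is_derive_mul (is_derive_const s) (is_derive_y 3)) is_derive_root_S2.
have Hd := is_derive_mul (is_derive_const 9) (is_derive_expr 2 (is_derive_y 2)).
have d0 : 9 * q ^+ 3 != 0 by rewrite mulf_neq0// expf_neq0.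
have H : is_derive x 1 (height1 y) _ := is_derive_div Hn Hd d0.
apply: is_derive_eq H _.
rewrite /arc_rate /height1 /height2 /curvature -/(root_S2 y x).
move: q r u v w e s q0 w0 s0 ss ee ww
  => Q r3 r4 r5 W E S Q0 W0 S0 SS EE WW.
by field: SS EE WW; rewrite Q0 W0 S0.
Qed.

Lemma is_derive_height2 : is_derive x 1 (height2 y)
  ((arc_rate y x)^-1 * (- height1 y x + e * k * height2 y x)).
Proof.
have Hn := is_derive_expr 1 is_derive_root_S2.
have Hd := is_derive_mul (is_derive_const 3) (is_derive_expr 2 (is_derive_y 2)).
have d0 : 3 * q ^+ 3 != 0 by rewrite mulf_neq0// expf_neq0.
have H : is_derive x 1 (height2 y) _ := is_derive_div Hn Hd d0.
apply: is_derive_eq H _.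
rewrite /arc_rate /height1 /height2 /curvature -/(root_S2 y x).
move: q r u v w e s q0 w0 s0 ss ee ww
  => Q r3 r4 r5 W E S Q0 W0 S0 SS EE WW.
by field: SS EE WW; rewrite Q0 W0 S0.
Qed.

Lemma arc_rate_neq0 : arc_rate y x != 0.
Proof. by rewrite mulf_neq0 ?mulf_neq0 ?invr_eq0. Qed.

(** * The moving equation *)

Lemma is_derive_right_frame : is_derive x 1 (right_frame y)
  ((arc_rate y x)^-1 *: (frame_matrix y x *m right_frame y x)).
Proof.
have Dpa := is_derive_mul (is_derive_y 1) is_derive_height1.
have Dpb := is_derive_mul (is_derive_y 1) is_derive_height2.
have rho0 := arc_rate_neq0; have rho_b := arc_rate_height2.
apply: is_derive_mx => i j.
rewrite [X in is_derive _ _ _ X]mxE mulmx2E.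
move: (right_frame00 y x) (right_frame01 y x) (right_frame10 y x).
move: (right_frame11 y x) (frame_matrix00 y x) (frame_matrix01 y x).
move: (frame_matrix10 y x) (frame_matrix11 y x).
(* Opaque matrices keep the selection of entries from unfolding the iterated
   derivatives. *)
generalize (right_frame y x) (frame_matrix y x)
  => F M M10 M11 F11 M00 M01 F00 F01 F10.
case: (ord2P i) => ->; case: (ord2P j) => ->.
- rewrite (funext (right_frame00 y)) M00 F00 M01 F10.
  apply: is_derive_eq (is_deriveB is_derive_tangent_part Dpa) _.
  move: rho0; move: p q e k => ? ? ? ?.
  move: (arc_rate y x) (tangent_part y x) (height1 y x) (height2 y x) => *.
  by field.
- rewrite (funext (right_frame01 y)) M00 F01 M01 F11.
  exact: is_derive_height1.
- rewrite (funext (right_frame10 y)) M10 F00 M11 F10.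
  apply: is_derive_eq (is_deriveN Dpb) _.
  rewrite -rho_b; move: rho0; move: p q e k => ? ? ? ?.
  move: (arc_rate y x) (height1 y x) (height2 y x) => *.
  by field.
- rewrite (funext (right_frame11 y)) M10 F01 M11 F11.
  by apply: is_derive_eq is_derive_height2 _; rewrite mulN1r.
Qed.

End Derivatives.

Theorem theorem4p2 (R : realType) (D : set R) (y : R -> R)
    (D_open : open D) (D_itv : is_interval D)
    (y_smooth : smooth_on D y) (y_regular : regular_on D y) :
  forall x : R, D x ->
    derivable (right_frame y) x 1 /\
    dds y (right_frame y) x = frame_matrix y x *m right_frame y x.
Proof.
move=> x Dx; have [dF F'] := is_derive_right_frame y_smooth y_regular Dx.
split=> //; rewrite /dds -/(root_S2 y x) -/(arc_rate y x) derive1E F'.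
have rho0 : arc_rate y x != 0 := arc_rate_neq0 y_regular Dx.
by rewrite scalerA mulfV ?scale1r.
Qed.
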